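(* There are positive constants $C_0,C_1$ such that $$\lim_{\theta\downarrow 0}\theta^{-1}\big(1-I(\theta)\big)=C_0\qquad\text{and}\qquad\lim_{\theta\uparrow\infty}\theta^{d}\,I(\theta)=C_1.$$
   Context: Let $d\ge 1$ be an integer and $\alpha>d$. $B(a,b)$ is the Beta function and $\tilde B(x,a,b)=\frac{1}{B(a,b)}\int_0^x v^{a-1}(1-v)^{b-1}\,dv$ the normalized incomplete Beta function. For $\theta\ge 0$, $$I(\theta)=\frac{1}{B(\alpha-d+1,d)}\int_0^1 v^{\alpha-d}(1-v)^{d-1}\,\varphi_\theta(v)\,dv,$$ where the weight $\varphi_\theta(v)$ is defined by $$\frac{1}{\varphi_\theta(v)}=1-\tilde B(v,\alpha-d,d)+(1+\theta)^\alpha\big(\tfrac{\theta}{v}+1\big)^{d-\alpha}\,\tilde B\big(\tfrac{v+\theta}{1+\theta},\alpha-d,d\big).$$ *)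

(* Defs.v *)
From HB Require Import structures.
From mathcomp Require Import all_boot all_order all_algebra.
From mathcomp Require Import all_classical all_reals all_analysis.

Set Implicit Arguments.
Unset Strict Implicit.
Unset Printing Implicit Defensive.

Import Order.TTheory GRing.Theory Num.Theory.
Import numFieldNormedType.Exports.

Local Open Scope classical_set_scope.
Local Open Scope ring_scope.

(* The Beta function for real a, b > 0 (the library's [beta_fun] only takes
   natural parameters). The integrand may be unbounded near the endpoints; as
   a Lebesgue integral this needs no improper limit, and the conventional
   values of [powR] at base 0 only matter on a null set. *)
Definition Beta {R : realType} (a b : R) : R :=
  \int[lebesgue_measure]_(v in `[0, 1]) (v `^ (a - 1) * (1 - v) `^ (b - 1)).

Definition Btilde {R : realType} (x a b : R) : R :=
  (Beta a b)^-1 *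
  \int[lebesgue_measure]_(v in `[0, x]) (v `^ (a - 1) * (1 - v) `^ (b - 1)).

Definition phi {R : realType} (d : nat) (alpha theta v : R) : R :=
  (1 - Btilde v (alpha - d%:R) d%:R
   + (1 + theta) `^ alpha * (theta / v + 1) `^ (d%:R - alpha)
     * Btilde ((v + theta) / (1 + theta)) (alpha - d%:R) d%:R)^-1.

Definition Ifun {R : realType} (d : nat) (alpha theta : R) : R :=
  (Beta (alpha - d%:R + 1) d%:R)^-1 *
  \int[lebesgue_measure]_(v in `[0, 1])
    (v `^ (alpha - d%:R) * (1 - v) `^ (d%:R - 1) * phi d alpha theta v).

(* Main.v *)
Require Import Defs.
From mathcomp Require Import all_boot all_order all_algebra.
From mathcomp Require Import all_classical all_reals all_analysis.
From mathcomp Require Import measurable_realfun ring.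

Import Order.TTheory GRing.Theory Num.Theory.
Import numFieldNormedType.Exports.

Local Open Scope classical_set_scope.
Local Open Scope ring_scope.

(** Write a = alpha - d > 0, n = d - 1 and u = (v + theta) / (1 + theta). Since
    d is an integer, (1 - s)^n is a polynomial and everything is expressed by
    the moments of polynomials against s^(a - 1) ds on [0, 1] ([moment]). The
    substitution s -> x s turns the incomplete Beta function into x^a times the
    moment of (1 - x s)^n, up to normalization ([BtildeE]); the identity
    (1 + theta) (1 - u s) = (1 - v s) + theta (1 - s) then expands the second
    incomplete Beta function in powers of theta. All the non-polynomial factors
    collapse and, for 0 < v <= 1 ([phiE]),

      phi_theta(v) = 1 / (1 + theta v^a T_v(theta)),

    where T_v ([excess]) is a polynomial in theta of degree n with nonnegative
    coefficients, constant coefficient at least 1 and leading coefficient 1.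

    - As theta goes to 0, (1 - phi_theta(v)) / theta tends to v^a T_v(0), and
      it is bounded by a constant: by v^a T_v(theta) when theta <= 1 and by
      1 / theta otherwise ([Ifun_near0]).
    - As theta goes to infinity, theta^d phi_theta(v) tends to v^(- a), and it is
      at most v^(- a) because T_v(theta) >= theta^n; the singularity is
      compensated by the factor v^a of the weight ([Ifun_at_infinity]).

    Dominated convergence gives both limits, and T_v(0) >= 1 makes the first
    one positive. *)

(** * Moments of polynomials against a power *)

Section moments.
Context {R : realType}.
Notation mu := (@lebesgue_measure R).
Implicit Types (a b c x v : R) (p q : {poly R}).

(** The integrand is unbounded near 0 when b < 1, so the fundamental theorem of
    calculus is applied on [x / (k + 2), x] and k is sent to infinity. *)
Lemma integral_powR_segment b x : 0 < b -> 0 < x ->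
  (\int[mu]_(v in `[0%R, x]) (v `^ (b - 1))%:E = (x `^ b / b)%:E)%E.
Proof.
move=> b0 x0.
(* k + 2 rather than k + 1 keeps the segments non-degenerate. *)
pose F (k : nat) : set R := `[x / k.+2%:R, x]%classic.
have xk0 k : 0 < x / k.+2%:R by rewrite divr_gt0.
have cup : \bigcup_k F k = `]0, x]%classic.
  apply/seteqP; split=> v /=.
    move=> [k _]; rewrite /F /= !in_itv/= => /andP[h ->]; rewrite andbT.
    exact: lt_le_trans h.
  rewrite in_itv/= => /andP[v0 vx].
  exists (Num.truncn (x / v)) => //; rewrite /F/= in_itv/= vx andbT.
  rewrite ler_pdivrMr// mulrC -ler_pdivrMr//.
  have := truncnS_gt (x / v) => /ltW/le_trans; apply.
  by rewrite ler_nat.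
have stepE k : (\int[mu]_(v in F k) (v `^ (b - 1))%:E =
    (x `^ b / b)%:E - ((x / k.+2%:R) `^ b / b)%:E)%E.
  have xkx : x / k.+2%:R < x.
    by rewrite ltr_pdivrMr// ltr_pMr// ltr1n.
  have dpow v c : 0 < v -> derivable (fun y : R => y `^ c) v 1.
    by move=> v0; apply: derivable_powR; rewrite in_itv/= v0.
  have cpow v c : 0 < v -> {for v, continuous (fun y : R => y `^ c)}.
    move=> v0; apply: differentiable_continuous.
    exact/derivable1_diffP/dpow.
  apply: (@continuous_FTC2 R _ (fun y => y `^ b / b)) => //.
  - apply: continuous_in_subspaceT => v; rewrite inE/= in_itv/= => /andP[h _].
    by apply: cpow; exact: lt_le_trans h.
  - split.
    + move=> v; rewrite in_itv/= => /andP[h _].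
      by apply: derivableM => //; apply: dpow; exact: lt_trans h.
    + apply: cvgM; last exact: cvg_cst.
      by apply: cvg_at_right_filter; apply: cpow.
    + apply: cvgM; last exact: cvg_cst.
      by apply: cvg_at_left_filter; apply: cpow.
  - move=> v; rewrite in_itv/= => /andP[h _].
    have v0 : 0 < v by exact: lt_trans h.
    rewrite derive1E deriveMr//; last exact: dpow.
    rewrite -derive1E powR_derive1 ?in_itv/= ?v0//.
    by rewrite /GRing.scale/=; field; rewrite gt_eqF.
rewrite -integral_itv_obnd_cbnd; last first.
  by apply/measurable_EFinP/measurable_funTS; exact: measurable_powR.
rewrite -cup.
have cv1 : (\int[mu]_(v in F k) (v `^ (b - 1))%:E)%E @[k --> \oo] -->
    (\int[mu]_(v in \bigcup_k F k) (v `^ (b - 1))%:E)%E.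
  apply: ge0_nondecreasing_set_cvg_integral.
  - move=> m n mn; rewrite subsetEset /F; apply: subset_itvr.
    rewrite bnd_simp ler_pM2l// lef_pV2 ?posrE// ler_nat.
    by rewrite !ltnS.
  - by move=> k; exact: measurable_itv.
  - by move=> k; apply/measurable_EFinP/measurable_funTS; exact: measurable_powR.
  - by move=> k v _; rewrite lee_fin powR_ge0.
apply: (cvg_unique _ cv1) => //.
rewrite (_ : (fun k => _) = EFin \o (fun k : nat =>
    x `^ b / b - (x / k.+2%:R) `^ b / b)); last exact/funext.
apply: cvg_EFin; first by near=> k.
rewrite [X in _ --> X](_ : _ = x `^ b / b - 0 / b); last by rewrite mul0r subr0.
apply: cvgB; first exact: cvg_cst.
apply: cvgM; last exact: cvg_cst.
have /cvg_at_rightP := @powR_cvg0 R b b0.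
apply; split=> //.
rewrite -(mulr0 x); apply: cvgM; first exact: cvg_cst.
have := @cvg_harmonic R; rewrite -(cvg_shiftn 1).
by under eq_fun do rewrite /harmonic addn1.
Unshelve. all: by end_near. Qed.

Definition moment_to x a p : R := \int[mu]_(v in `[0, x]) (v `^ (a - 1) * p.[v]).

Definition moment a p : R := moment_to 1 a p.

(** Multiplying a polynomial by the variable amounts to raising the exponent of
    the weight by one: the inductions on polynomials below therefore let the
    exponent vary. *)
Lemma powR_horner_cons a v p c : 0 < a -> 0 <= v ->
  v `^ (a - 1) * (p * 'X + c%:P).[v] =
  v `^ (a + 1 - 1) * p.[v] + c * v `^ (a - 1).
Proof.
move=> a0 v0; rewrite hornerMXaddC mulrDr [c * _]mulrC; congr (_ + _).
by rewrite addrK -(mulr_powRB1 v0 a0); ring.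
Qed.

Lemma integrable_powR_segment a x : 0 < a -> 0 < x ->
  mu.-integrable `[0, x] (EFin \o (fun v => v `^ (a - 1))).
Proof.
move=> a0 x0; apply/integrableP; split.
  by apply/measurable_EFinP/measurable_funTS; exact: measurable_powR.
under eq_integral do rewrite /= ger0_norm ?powR_ge0//.
by rewrite integral_powR_segment// ltry.
Qed.

Lemma integrable_powR_horner a x p : 0 < a -> 0 < x ->
  mu.-integrable `[0, x] (EFin \o (fun v => v `^ (a - 1) * p.[v])).
Proof.
move=> a0 x0; elim/poly_ind: p a a0 => [|p c ih] a a0.
  apply: (eq_integrable _ (cst 0%E)) => //; last exact: integrable0.
  by move=> v _; rewrite /= horner0 mulr0.
have a10 : 0 < a + 1 by rewrite addr_gt0.
apply: (@eq_integrable _ (measurableTypeR R) R mu `[0, x] _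
    ((EFin \o (fun v => (v `^ (a + 1 - 1) * p.[v])%R)) \+
     (EFin \o (fun v => (c * v `^ (a - 1))%R)))%E) => //.
  move=> v; rewrite inE/= in_itv/= => /andP[v0 _].
  by rewrite powR_horner_cons.
apply: integrableD => //; first exact: ih.
rewrite (_ : _ \o _ = (fun v => c%:E * (EFin \o (fun v => v `^ (a - 1))%R) v)%E)//.
by apply: integrableZl => //; exact: integrable_powR_segment.
Qed.

Lemma moment_toD x a p q : 0 < a -> 0 < x ->
  moment_to x a (p + q) = moment_to x a p + moment_to x a q.
Proof.
move=> a0 x0; rewrite /moment_to -RintegralD//.
- by apply: eq_Rintegral => v _; rewrite hornerD mulrDr.
- exact: integrable_powR_horner.
- exact: integrable_powR_horner.
Qed.

Lemma moment_toZ x a c p : 0 < a -> 0 < x ->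
  moment_to x a (c *: p) = c * moment_to x a p.
Proof.
move=> a0 x0; rewrite /moment_to -RintegralZl//.
- by apply: eq_Rintegral => v _; rewrite hornerZ mulrCA.
- exact: integrable_powR_horner.
Qed.

Lemma moment_toB x a p q : 0 < a -> 0 < x ->
  moment_to x a (p - q) = moment_to x a p - moment_to x a q.
Proof. by move=> a0 x0; rewrite -scaleN1r moment_toD// moment_toZ// mulN1r. Qed.

Lemma moment_toMX x a p : 0 < a -> moment_to x a (p * 'X) = moment_to x (a + 1) p.
Proof.
move=> a0; apply: eq_Rintegral => v; rewrite inE/= in_itv/= => /andP[v0 _].
by have := powR_horner_cons a v p 0 a0 v0; rewrite mul0r !addr0.
Qed.

Lemma moment_toC x a c : 0 < a -> 0 < x -> moment_to x a c%:P = c * (x `^ a / a).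
Proof.
move=> a0 x0; rewrite -alg_polyC moment_toZ//; congr (_ * _).
rewrite /moment_to; under eq_Rintegral do rewrite hornerC mulr1.
by rewrite /Rintegral integral_powR_segment.
Qed.

(** The substitution v = x s. The induction on p reduces it to constants, where
    both sides are explicit, and so avoids a change of variables for a singular
    integrand. *)
Lemma moment_to_scale x a p : 0 < a -> 0 < x ->
  moment_to x a p = x `^ a * moment a (p \Po (x *: 'X)).
Proof.
move=> a0 x0; elim/poly_ind: p a a0 => [|p c ih] a a0.
  by rewrite comp_poly0 -(scale0r 0) /moment !moment_toZ// !mul0r mulr0.
have a10 : 0 < a + 1 by rewrite addr_gt0.
rewrite comp_polyD comp_polyM comp_polyX comp_polyC -scalerAr /moment.
rewrite !moment_toD// moment_toZ// !moment_toMX// ih// !moment_toC//.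
rewrite powR1/= powRD ?(gt_eqF x0) ?implybT// powRr1 ?ltW//.
by rewrite /moment; ring.
Qed.

Lemma le_moment a p q : 0 < a ->
  (forall v, 0 <= v <= 1 -> p.[v] <= q.[v]) -> moment a p <= moment a q.
Proof.
move=> a0 pq; apply: le_Rintegral => //.
- exact: integrable_powR_horner.
- exact: integrable_powR_horner.
- move=> v; rewrite /= in_itv/= => v01.
  by rewrite ler_wpM2l ?powR_ge0 ?pq.
Qed.

(** The Beta function B(a, n + 1) in closed form, by induction on n from
    B(a, n + 2) = B(a, n + 1) - B(a + 1, n + 1); its positivity follows. *)
Lemma moment_onemX_exp a n : 0 < a ->
  moment a ((1 - 'X) ^+ n) = n`!%:R / \prod_(i < n.+1) (a + i%:R).
Proof.
elim: n a => [|n ih] a a0.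
  rewrite expr0 -polyC1 /moment moment_toC// powR1/=.
  by rewrite big_ord_recl big_ord0 addr0 mulr1 !mul1r.
have a10 : 0 < a + 1 by rewrite addr_gt0.
rewrite exprSr mulrBr mulr1 /moment moment_toB// moment_toMX// -!/(moment _ _) !ih//.
(* P is the factor (a + 1) .. (a + n) common to the three products. *)
pose P := \prod_(i < n) (a + 1 + i%:R).
have PE b m : \prod_(i < m.+1) (b + i%:R) = b * \prod_(i < m) (b + 1 + i%:R) :> R.
  rewrite big_ord_recl addr0; congr (_ * _).
  by apply: eq_bigr => i _; rewrite /bump/= natrD addrA.
have P0 : P != 0.
  by rewrite gt_eqF// prodr_gt0// => i _; rewrite ltr_wpDr.
have an0 : a + n.+1%:R != 0 by rewrite gt_eqF// ltr_wpDr.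
rewrite [in RHS]PE PE [in RHS]big_ord_recr/= big_ord_recr/= -/P.
have an1 : a + 1 + n%:R = a + n.+1%:R by rewrite -addrA -natr1 [1 + _]addrC.
rewrite an1 factS natrM.
have -> : n.+1%:R * n`!%:R = ((a + n.+1%:R) - a) * n`!%:R :> R.
  by rewrite [a + _]addrC addrK.
move: (a + n.+1%:R) an0 => s s0.
by field; rewrite s0 P0 (gt_eqF a0).
Qed.

Lemma moment_onemX_exp_gt0 a n : 0 < a -> 0 < moment a ((1 - 'X) ^+ n).
Proof.
move=> a0; rewrite moment_onemX_exp// divr_gt0 ?ltr0n ?fact_gt0//.
by rewrite prodr_gt0// => i _; rewrite ltr_wpDr.
Qed.

(** Splitting off one factor 1 - v s shows by induction that this is a
    polynomial in v. *)
Lemma measurable_moment_pencil a n q : 0 < a ->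
  measurable_fun setT (fun v => moment a ((1 - v *: 'X) ^+ n * q)).
Proof.
move=> a0; elim: n q => [|n ih] q.
  by under eq_fun do rewrite expr0 mul1r; exact: measurable_cst.
have -> : (fun v => moment a ((1 - v *: 'X) ^+ n.+1 * q)) =
    (fun v => moment a ((1 - v *: 'X) ^+ n * q) -
              v * moment a ((1 - v *: 'X) ^+ n * ('X * q))).
  apply/funext => v; rewrite exprSr -mulrA mulrBl mul1r mulrBr.
  by rewrite -scalerAl -scalerAr /moment moment_toB// moment_toZ.
apply: measurable_funB => //; apply: measurable_funM => //.
Qed.

End moments.

(** * The weight as the inverse of a polynomial in theta *)

Section weight.
Context {R : realType}.
Variables (a : R) (n : nat).
Hypothesis a0 : 0 < a.
Implicit Types (x v theta : R).

(** Up to binomial coefficients, the coefficients of the powers of theta in the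
    normalized moment of ((1 - v s) + theta (1 - s))^n; see [moment_shifted]. *)
Definition mixed_moment j v : R :=
  moment a ((1 - v *: 'X) ^+ (n - j) * (1 - 'X) ^+ j) / moment a ((1 - 'X) ^+ n).

(** These are the coefficients of T_v = ((1 + theta) S - S(0)) / theta, where
    S = sum_i C(n, i) (mixed_moment i v) theta^i: the term theta of 1 + theta
    gives the first summand, its term 1 the second. *)
Definition excess_coef i v : R :=
  'C(n, i)%:R * mixed_moment i v + 'C(n, i.+1)%:R * mixed_moment i.+1 v.

(** The polynomial T_v in theta such that 1 + theta v^a T_v(theta) is the
    inverse of the weight. *)
Definition excess v : {poly R} := \poly_(i < n.+1) excess_coef i v.

Let norm_gt0 : 0 < moment a ((1 - 'X) ^+ n : {poly R}).
Proof. exact: moment_onemX_exp_gt0. Qed.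

Let horner_rules := (hornerM, horner_exp, hornerD, hornerN, hornerZ, hornerX, hornerC).

Lemma mixed_moment_ge0 j v : 0 <= v <= 1 -> 0 <= mixed_moment j v.
Proof.
move=> /andP[v0 v1]; rewrite divr_ge0 ?(ltW norm_gt0)//.
apply: Rintegral_ge0 => s; rewrite /= in_itv/= => /andP[s0 s1].
rewrite !horner_rules !mulr_ge0 ?powR_ge0// exprn_ge0// subr_ge0//.
exact: mulr_ile1.
Qed.

Lemma mixed_moment_le j v : 0 <= v <= 1 ->
  mixed_moment j v <= moment a 1 / moment a ((1 - 'X) ^+ n).
Proof.
move=> /andP[v0 v1]; rewrite ler_pM2r ?invr_gt0//.
apply: le_moment => // s /andP[s0 s1].
rewrite !horner_rules mulr_ile1// ?exprn_ge0 ?exprn_ile1 ?subr_ge0 ?mulr_ile1//.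
- by rewrite lerBlDr lerDl mulr_ge0.
- by rewrite lerBlDr lerDl.
Qed.

(** 1 - s <= 1 - v s on the unit interval, so that the moment dominates its
    normalization. *)
Lemma mixed_moment_ge1 j v : (j <= n)%N -> 0 <= v <= 1 -> 1 <= mixed_moment j v.
Proof.
move=> jn /andP[v0 v1]; rewrite ler_pdivlMr// mul1r.
apply: le_moment => // s /andP[s0 s1].
rewrite -{1}(subnK jn) exprD !horner_rules ler_wpM2r ?exprn_ge0 ?subr_ge0//.
by rewrite lerXn2r ?nnegrE ?subr_ge0 ?mulr_ile1// lerD2l lerN2 ler_piMl.
Qed.

Lemma mixed_moment_last v : mixed_moment n v = 1.
Proof. by rewrite /mixed_moment subnn expr0 mul1r divff// gt_eqF. Qed.

Lemma excess_coef_ge0 i v : 0 <= v <= 1 -> 0 <= excess_coef i v.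
Proof. by move=> v01; rewrite addr_ge0// mulr_ge0 ?mixed_moment_ge0. Qed.

Lemma excess_coef_last v : excess_coef n v = 1.
Proof.
by rewrite /excess_coef binn bin_small// mul0r addr0 mul1r mixed_moment_last.
Qed.

Lemma excess_hornerE v theta :
  (excess v).[theta] = \sum_(i < n.+1) excess_coef i v * theta ^+ i.
Proof. exact: horner_poly. Qed.

Lemma excess_term_le v theta (i : 'I_n.+1) : 0 <= v <= 1 -> 0 <= theta ->
  excess_coef i v * theta ^+ i <= (excess v).[theta].
Proof.
move=> v01 t0; rewrite excess_hornerE (bigD1 i)//= lerDl sumr_ge0// => k _.
by rewrite mulr_ge0 ?excess_coef_ge0 ?exprn_ge0.
Qed.

(** All coefficients are nonnegative, and the constant one contains the moment
    of index 0, which is at least 1. *)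
Lemma excess_ge1 v theta : 0 <= v <= 1 -> 0 <= theta -> 1 <= (excess v).[theta].
Proof.
move=> v01 t0; apply: le_trans (@excess_term_le v theta ord0 v01 t0).
rewrite expr0 mulr1 /excess_coef bin0 mul1r.
by rewrite -[leLHS]addr0 lerD ?mixed_moment_ge1// mulr_ge0 ?mixed_moment_ge0.
Qed.

(** The leading coefficient is 1; this is the growth that makes
    theta^d phi_theta(v) bounded by v^(- a). *)
Lemma excess_ge_expn v theta : 0 <= v <= 1 -> 0 <= theta ->
  theta ^+ n <= (excess v).[theta].
Proof.
move=> v01 t0; apply: le_trans (@excess_term_le v theta ord_max v01 t0).
by rewrite excess_coef_last mul1r.
Qed.

Lemma excess_bounded : exists2 K : R, 0 <= K &
  forall v theta, 0 <= v <= 1 -> 0 <= theta <= 1 -> (excess v).[theta] <= K.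
Proof.
set c := moment a 1 / moment a ((1 - 'X : {poly R}) ^+ n).
have c0 : 0 <= c.
  apply: le_trans (@mixed_moment_le 0 0 _); last by rewrite lexx ler01.
  by rewrite mixed_moment_ge0// lexx ler01.
exists (\sum_(i < n.+1) ('C(n, i)%:R * c + 'C(n, i.+1)%:R * c)).
  by apply: sumr_ge0 => i _; rewrite addr_ge0// mulr_ge0.
move=> v theta v01 /andP[t0 t1]; rewrite excess_hornerE; apply: ler_sum => i _.
rewrite -[leRHS]mulr1 ler_pM ?excess_coef_ge0 ?exprn_ge0 ?exprn_ile1//.
by rewrite lerD// ler_wpM2l// mixed_moment_le.
Qed.

(** With s = 1 / theta the polynomial is read backwards, so its behaviour at
    infinity is the behaviour of another polynomial at 0. *)
Lemma excess_reverse v theta : theta != 0 ->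
  (excess v).[theta] / theta ^+ n =
  (\poly_(i < n.+1) excess_coef (n - i)%N v).[theta^-1].
Proof.
move=> t0; rewrite excess_hornerE horner_poly mulr_suml.
rewrite (reindex_inj rev_ord_inj)/=; apply: eq_bigr => i _.
rewrite subSS -mulrA; congr (_ * _).
have i_n : (i <= n)%N by rewrite -ltnS.
by rewrite expfB_cond ?(negbTE t0)// mulrAC divff ?expf_neq0// mul1r exprVn.
Qed.

Lemma measurable_excess theta :
  measurable_fun setT (fun v => (excess v).[theta]).
Proof.
under eq_fun do rewrite excess_hornerE.
apply: measurable_sum => i; apply: measurable_funM => //.
have mm j : measurable_fun setT (mixed_moment j).
  by apply: measurable_funM => //; exact: measurable_moment_pencil.
by apply: measurable_funD; apply: measurable_funM.
Qed.

(** The term of index 0 of the sum cancels mixed_moment 0 v, and what remains is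
    divisible by theta. *)
Lemma excess_expansion v theta :
  1 + theta * (excess v).[theta] =
  1 - mixed_moment 0 v +
    (1 + theta) * \sum_(i < n.+1) 'C(n, i)%:R * mixed_moment i v * theta ^+ i.
Proof.
set S := \sum_(i < _) _.
have SE : S = mixed_moment 0 v +
    theta * \sum_(i < n.+1) 'C(n, i.+1)%:R * mixed_moment i.+1 v * theta ^+ i.
  rewrite big_ord_recr/= (bin_small (ltnSn n)) !mul0r addr0 /S.
  rewrite big_ord_recl/= bin0 mul1r mulr1 mulr_sumr; congr (_ + _).
  by apply: eq_bigr => i _; rewrite /bump/= exprS; ring.
have -> : (excess v).[theta] = S +
    \sum_(i < n.+1) 'C(n, i.+1)%:R * mixed_moment i.+1 v * theta ^+ i.
  by rewrite excess_hornerE -big_split; apply: eq_bigr => i _; rewrite mulrDl.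
by rewrite [in RHS]mulrDl mul1r [X in _ + (X + _)]SE; ring.
Qed.

Lemma BetaE b : Beta b n.+1%:R = moment b ((1 - 'X : {poly R}) ^+ n).
Proof.
apply: eq_Rintegral => v; rewrite inE/= in_itv/= => /andP[v0 v1].
by rewrite !horner_rules -natr1 addrK powR_mulrn// subr_ge0.
Qed.

Lemma BtildeE x : 0 < x <= 1 ->
  Btilde x a n.+1%:R =
  x `^ a * moment a ((1 - x *: 'X) ^+ n) / moment a ((1 - 'X) ^+ n).
Proof.
move=> /andP[x0 x1]; rewrite /Btilde BetaE mulrC; congr (_ / _).
have -> : (1 - x *: 'X : {poly R}) ^+ n = ((1 - 'X) ^+ n) \Po (x *: 'X).
  by rewrite rmorphXn/= comp_polyB comp_polyX comp_polyC.
rewrite -moment_to_scale//.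
apply: eq_Rintegral => v; rewrite inE/= in_itv/= => /andP[v0 vx].
by rewrite !horner_rules -natr1 addrK powR_mulrn// subr_ge0 (le_trans vx).
Qed.

(** With u = (v + theta) / (1 + theta), expand
    (1 + theta)^n (1 - u s)^n = ((1 - v s) + theta (1 - s))^n by the binomial
    formula and take moments in s. *)
Lemma moment_shifted v theta : 0 <= theta ->
  (1 + theta) ^+ n * moment a ((1 - ((v + theta) / (1 + theta)) *: 'X) ^+ n) /
    moment a ((1 - 'X) ^+ n) =
  \sum_(i < n.+1) 'C(n, i)%:R * mixed_moment i v * theta ^+ i.
Proof.
move=> t0.
have t10 : 1 + theta != 0 by rewrite gt_eqF// ltr_wpDr.
rewrite -[_ * moment _ _]moment_toZ// -exprZn scalerBr scalerA.
rewrite mulrCA divff// mulr1.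
have -> : (1 + theta)%:A - (v + theta) *: 'X =
    (1 - v *: 'X) + theta *: (1 - 'X) :> {poly R}.
  by rewrite !scalerDl scalerBr scale1r; ring.
rewrite exprDn.
have sumE (I : Type) (r : seq I) (F : I -> {poly R}) :
    moment a (\sum_(i <- r) F i) = \sum_(i <- r) moment a (F i).
  apply: (big_morph (moment a)) => [p q|]; first exact: moment_toD.
  by rewrite -(scale0r 0) /moment moment_toZ// mul0r.
rewrite -/(moment _ _) sumE mulr_suml; apply: eq_bigr => i _.
rewrite -scaler_nat exprZn -scalerAr scalerA /moment moment_toZ//.
by rewrite /mixed_moment /moment; ring.
Qed.

(** The point v = 0 is left out: there theta / v is 0 by convention and the
    formula fails for theta > 0, but a point is negligible for the integral. *)
Lemma phiE alpha v theta : alpha - n.+1%:R = a -> 0 < v <= 1 -> 0 <= theta ->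
  phi n.+1 alpha theta v = (1 + theta * v `^ a * (excess v).[theta])^-1.
Proof.
move=> alphaE /andP[v0 v1] t0.
have t10 : 0 < 1 + theta by rewrite ltr_wpDr.
have vt0 : 0 < v + theta by rewrite ltr_wpDr.
have u01 : 0 < (v + theta) / (1 + theta) <= 1.
  by rewrite divr_gt0//= ler_pdivrMr// mul1r lerD2r.
rewrite /phi; congr (_^-1).
rewrite -[n.+1%:R - alpha]opprB alphaE !BtildeE ?v0//.
(* The powers of v + theta cancel, since theta / v + 1 = (v + theta) / v. *)
have powE : (1 + theta) `^ alpha * (theta / v + 1) `^ (- a) *
    ((v + theta) / (1 + theta)) `^ a = (1 + theta) ^+ n.+1 * v `^ a.
  have -> : theta / v + 1 = (v + theta) * v^-1.
    by rewrite mulrDl divff ?gt_eqF// addrC.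
  have -> : alpha = n.+1%:R + a by rewrite -alphaE addrC subrK.
  rewrite powRD ?(gt_eqF t10) ?implybT// powR_mulrn ?(ltW t10)//.
  have powRV y : 0 < y -> y^-1 `^ a = (y `^ a)^-1.
    by move=> y0; rewrite -[y^-1]powR_inv1 ?ltW// -powRrM mulN1r powRN.
  rewrite powRN !powRM ?invr_ge0 ?ltW// !powRV//.
  have := powR_gt0 a t10; have := powR_gt0 a vt0; have := powR_gt0 a v0.
  move: (_ `^ a) (_ `^ a) (_ `^ a) => p q r p0 q0 r0.
  by field; rewrite !gt_eqF.
rewrite !mulrA powE -[theta * _ * _]mulrA mulrCA.
have := excess_expansion v theta; rewrite -moment_shifted//.
rewrite /mixed_moment subn0 expr0 mulr1 exprS => e.
have -> : theta * (excess v).[theta] = (1 + theta * (excess v).[theta]) - 1 by ring.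
by rewrite e; ring.
Qed.

End weight.

(** * Bounded convergence along a real parameter *)

Section unit_interval.
Context {R : realType}.
Notation mu := (@lebesgue_measure R).
Notation D := (`]0%R, 1%R]%classic : set R).
Implicit Types (f l : R -> R) (h : R -> R -> R) (K : R).

Lemma integrable_unit_interval f K : measurable_fun D f ->
  (forall v, 0 < v <= 1 -> `|f v| <= K) -> mu.-integrable D (EFin \o f).
Proof.
move=> mf fK; apply: (@le_integrable _ _ _ mu D _ _ (EFin \o cst K)) => //.
- exact/measurable_EFinP.
- move=> v; rewrite /= in_itv/= => v01; rewrite lee_fin.
  by rewrite (le_trans (fK _ v01))// ler_norm.
- apply/integrableP; split; first by apply/measurable_EFinP; exact: measurable_cst.
  rewrite /= integral_cst//= lebesgue_measure_itv/= lte01.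
  by rewrite -EFinB -EFinM ltry.
Qed.

Lemma cvg_Rintegral_bounded (h : nat -> R -> R) l K :
  (forall k, measurable_fun D (h k)) -> measurable_fun D l ->
  (forall k v, 0 < v <= 1 -> `|h k v| <= K) ->
  (forall v, 0 < v <= 1 -> h k v @[k --> \oo] --> l v) ->
  \int[mu]_(v in D) h k v @[k --> \oo] --> \int[mu]_(v in D) l v.
Proof.
move=> mh ml hK hl.
have iK : mu.-integrable D (EFin \o cst K).
  apply: (@integrable_unit_interval _ `|K|) => //.
have [] := @dominated_convergence _ _ R mu D (measurable_itv _)
  (fun k => EFin \o h k) (EFin \o l) (EFin \o cst K).
- by move=> k; apply/measurable_EFinP; exact: mh.
- exact/measurable_EFinP.
- apply: aeW => v; rewrite /= in_itv/= => v01.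
  by apply: cvg_EFin; [apply: nearW => k|exact: hl].
- exact: iK.
- by apply: aeW => v k; rewrite /= in_itv/= => v01; rewrite lee_fin hK.
move=> il _ cv; rewrite /Rintegral.
by apply: fine_cvg; rewrite fineK//; exact: integrable_fin_num.
Qed.

Lemma cvg_Rintegral_at_right0 h l K :
  (forall t, 0 < t -> measurable_fun D (h t)) -> measurable_fun D l ->
  (forall t v, 0 < t -> 0 < v <= 1 -> `|h t v| <= K) ->
  (forall v, 0 < v <= 1 -> h t v @[t --> 0^'+] --> l v) ->
  \int[mu]_(v in D) h t v @[t --> 0^'+] --> \int[mu]_(v in D) l v.
Proof.
move=> mh ml hK hl; apply/cvg_at_rightP => u [u0 ucv].
apply: (@cvg_Rintegral_bounded (fun k => h (u k)) l K) => //.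
- by move=> k; exact: mh.
- by move=> k v; exact: hK.
- by move=> v /hl/cvg_at_rightP; apply.
Qed.

(** A sequence tending to infinity is only eventually positive; it is shifted so
    that the hypotheses on positive parameters apply to all its terms. *)
Lemma cvg_Rintegral_pinfty h l K :
  (forall t, 0 < t -> measurable_fun D (h t)) -> measurable_fun D l ->
  (forall t v, 0 < t -> 0 < v <= 1 -> `|h t v| <= K) ->
  (forall v, 0 < v <= 1 -> h t v @[t --> +oo] --> l v) ->
  \int[mu]_(v in D) h t v @[t --> +oo] --> \int[mu]_(v in D) l v.
Proof.
move=> mh ml hK hl; apply/cvg_pinftyP => u ucv.
have /cvgryPgt/(_ 0)[N _ uN] := ucv.
have u0 k : 0 < u (k + N)%N by apply: uN; rewrite /= leq_addl.
rewrite -(cvg_shiftn N).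
apply: (@cvg_Rintegral_bounded (fun k => h (u (k + N)%N)) l K) => //.
- by move=> k; exact: mh.
- by move=> k v; exact: hK.
- move=> v /hl/cvg_pinftyP hv; apply: hv.
  by rewrite (cvg_shiftn N u).
Qed.

Lemma moment_unit_interval b (p : {poly R}) : 0 < b ->
  moment b p = \int[mu]_(v in D) (v `^ (b - 1) * p.[v]).
Proof.
move=> b0; rewrite /moment /moment_to Rintegral_itv_obnd_cbnd//.
apply: integrableS (integrable_powR_horner b 1 p b0 ltr01) => //.
exact: subset_itv_oc_cc.
Qed.

End unit_interval.

(** * The two limits *)

Section limits.
Context {R : realType}.
Notation mu := (@lebesgue_measure R).
Notation D := (`]0%R, 1%R]%classic : set R).
Variables (a : R) (n : nat).
Hypothesis a0 : 0 < a.
Implicit Types (v theta : R).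

Let w v : R := v `^ a * (1 - v) ^+ n.
Let T theta v : R := (excess a n v).[theta].
Let N : R := moment (a + 1) ((1 - 'X) ^+ n).

Let N_gt0 : 0 < N.
Proof. by apply: moment_onemX_exp_gt0; rewrite addr_gt0. Qed.

Let powR_ge0_le1 v : 0 < v <= 1 -> 0 < v `^ a <= 1.
Proof.
move=> /andP[v0 v1]; rewrite powR_gt0//=.
by rewrite -[leRHS](powRr0 v) ger_powR ?v0 ?(ltW a0).
Qed.

Let onemX_ge0_le1 v : 0 < v <= 1 -> 0 <= (1 - v) ^+ n <= 1.
Proof.
move=> /andP[v0 v1].
by rewrite exprn_ge0 ?exprn_ile1 ?subr_ge0// lerBlDr lerDl ltW.
Qed.

Let T_ge1 theta v : 0 <= theta -> 0 < v <= 1 -> 1 <= T theta v.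
Proof. by move=> t0 /andP[/ltW v0 v1]; apply: excess_ge1 => //; rewrite v0. Qed.

Let den_gt0 theta v : 0 <= theta -> 0 < v <= 1 ->
  0 < 1 + theta * v `^ a * T theta v.
Proof.
move=> t0 v01; rewrite ltr_pwDl// mulr_ge0 ?(le_trans ler01 (T_ge1 _ _ t0 v01))//.
by rewrite mulr_ge0 ?powR_ge0.
Qed.

Let measurable_w : measurable_fun D w.
Proof.
apply: measurable_funM; first by apply: measurable_funTS; exact: measurable_powR.
by apply: measurable_funX; apply: measurable_funB.
Qed.

Let measurable_T theta : measurable_fun D (T theta).
Proof. by apply: measurable_funTS; exact: measurable_excess. Qed.

Let measurable_pow : measurable_fun D (fun v => v `^ a).
Proof. by apply: measurable_funTS; exact: measurable_powR. Qed.

Let measurable_den theta : 0 <= theta ->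
  measurable_fun D (fun v => (1 + theta * v `^ a * T theta v)^-1).
Proof.
move=> t0; apply: (eq_measurable_fun
    (fun v => (1 + theta * v `^ a * T theta v) `^ (-1))).
  move=> v; rewrite inE/= in_itv/= => v01.
  by rewrite powR_inv1 ?(ltW (den_gt0 _ _ t0 v01)).
apply: (measurableT_comp (measurable_powR (-1))).
by apply: measurable_funD => //; do 2 apply: measurable_funM => //.
Qed.

Let w_bound v : 0 < v <= 1 -> 0 <= w v <= 1.
Proof.
move=> v01; have /andP[p0 p1] := powR_ge0_le1 _ v01.
have /andP[q0 q1] := onemX_ge0_le1 _ v01.
by rewrite mulr_ge0 ?(ltW p0)//= mulr_ile1// ltW.
Qed.

Let integrable_w : mu.-integrable D (EFin \o w).
Proof.
apply: (integrable_unit_interval _ 1) => // v /w_bound/andP[w0 w1].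
by rewrite ger0_norm.
Qed.

Let integrable_wphi theta : 0 <= theta ->
  mu.-integrable D (EFin \o (fun v => w v / (1 + theta * v `^ a * T theta v))).
Proof.
move=> t0; apply: (integrable_unit_interval _ 1).
  by apply: measurable_funM => //; exact: measurable_den.
move=> v v01; have /andP[w0 w1] := w_bound _ v01.
have d0 := den_gt0 _ _ t0 v01.
rewrite ger0_norm ?divr_ge0 ?(ltW d0)// ler_pdivrMr// mul1r (le_trans w1)//.
rewrite lerDl !mulr_ge0 ?powR_ge0//.
exact: le_trans ler01 (T_ge1 _ _ t0 v01).
Qed.

(** Removing the endpoint 0 from the domain makes [phiE] available on all of
    it. *)
Lemma IfunE alpha theta : alpha - n.+1%:R = a -> 0 <= theta ->
  Ifun n.+1 alpha theta =
  N^-1 * \int[mu]_(v in D) (w v / (1 + theta * v `^ a * T theta v)).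
Proof.
move=> alphaE t0; rewrite /Ifun alphaE BetaE; congr (_ * _).
have E v : v \in D ->
    v `^ a * (1 - v) `^ (n.+1%:R - 1) * phi n.+1 alpha theta v =
    w v / (1 + theta * v `^ a * T theta v).
  rewrite inE/= in_itv/= => /[dup] v01 /andP[v0 v1].
  by rewrite (phiE _ _ a0 alpha)// -natr1 addrK powR_mulrn ?subr_ge0.
rewrite -Rintegral_itv_obnd_cbnd; first exact: eq_Rintegral.
apply: eq_integrable (integrable_wphi _ t0) => // v vD.
by rewrite /= E.
Qed.

Let N_E : N = \int[mu]_(v in D) w v.
Proof.
rewrite /N moment_unit_interval ?addr_gt0//; apply: eq_Rintegral => v _.
by rewrite addrK horner_exp !hornerE.
Qed.

(** The weight w has total mass N, so 1 - I(theta) is the normalized integral of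
    w (1 - phi_theta). *)
Lemma Ifun_near0 alpha : alpha - n.+1%:R = a ->
  theta^-1 * (1 - Ifun n.+1 alpha theta) @[theta --> 0^'+] -->
  N^-1 * \int[mu]_(v in D) (w v * (v `^ a * T 0 v)).
Proof.
move=> alphaE.
pose h theta v := w v * (v `^ a * T theta v / (1 + theta * v `^ a * T theta v)).
have Ih theta : 0 < theta -> theta^-1 * (1 - Ifun n.+1 alpha theta) =
    N^-1 * \int[mu]_(v in D) h theta v.
  move=> t0; rewrite IfunE ?ltW// -[X in X - _](mulVf (lt0r_neq0 N_gt0)).
  rewrite -mulrBr mulrCA {2}N_E -RintegralB//; last exact/integrable_wphi/ltW.
  congr (_ * _); rewrite -RintegralZl//; last first.
    rewrite [X in integrable _ _ X](_ : _ =
      ((EFin \o w) \- (EFin \o (fun v => (w v / (1 + theta * v `^ a * T theta v))%R)))%E)//.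
    by apply: integrableB => //; exact/integrable_wphi/ltW.
  apply: eq_Rintegral => v; rewrite inE/= in_itv/= => v01.
  rewrite /h; have := den_gt0 _ _ (ltW t0) v01.
  move: (T _ _) (v `^ a) (w v) => x y z d0.
  by field; rewrite !gt_eqF.
apply: (@cvg_trans _ (N^-1 * \int[mu]_(v in D) h theta v @[theta --> 0^'+])).
  apply: near_eq_cvg; near=> theta; rewrite Ih//.
apply: cvgM; first exact: cvg_cst.
have [K K0 TK] := excess_bounded a n a0.
apply: (cvg_Rintegral_at_right0 _ _ (K + 1)).
- move=> theta t0; apply: measurable_funM => //; apply: measurable_funM.
    exact: measurable_funM.
  by apply: measurable_den; exact: ltW.
- by apply: measurable_funM => //; exact: measurable_funM.
- move=> theta v t0 v01; have /andP[w0 w1] := w_bound _ v01.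
  have /andP[p0 p1] := powR_ge0_le1 _ v01.
  have T1 := T_ge1 _ _ (ltW t0) v01; have T0 := le_trans ler01 T1.
  have d0 := den_gt0 _ _ (ltW t0) v01.
  have q0 : 0 <= v `^ a * T theta v / (1 + theta * v `^ a * T theta v).
    by rewrite divr_ge0 ?(ltW d0)// mulr_ge0 ?(ltW p0).
  have h0 : 0 <= h theta v by exact: mulr_ge0.
  suff hK : h theta v <= K + 1 by rewrite ger0_norm.
  apply: le_trans (ler_piMl q0 w1) _.
  have [t1|t1] := leP theta 1.
    (* x / (1 + theta x) <= x *)
    have TK' : T theta v <= K.
      by case/andP: v01 => /ltW v0 v1; apply: TK; rewrite ?v0 ?(ltW t0).
    rewrite ler_pdivrMr// (@le_trans _ _ K)//.
      by rewrite (le_trans _ TK')// ler_piMl.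
    rewrite -[leLHS]mulr1; apply: ler_pM => //; first by rewrite lerDl.
    by rewrite lerDl !mulr_ge0 ?(ltW t0) ?(ltW p0).
  (* x / (1 + theta x) <= 1 / theta <= 1 *)
  apply: (@le_trans _ _ 1); last by rewrite lerDr.
  rewrite ler_pdivrMr// mul1r.
  rewrite -[leLHS]add0r lerD// ler_wpM2r// ler_peMl ?(ltW p0) ?(ltW t1)//.
- move=> v v01; apply: cvg_at_right_filter; rewrite /h.
  have cT : T theta v @[theta --> 0] --> T 0 v by exact: continuous_horner.
  apply: cvgM; first exact: cvg_cst.
  have -> : v `^ a * T 0 v = v `^ a * T 0 v / (1 + 0 * v `^ a * T 0 v).
    by rewrite !mul0r addr0 divr1.
  apply: cvgM; first by apply: cvgM => //; exact: cvg_cst.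
  apply: cvgV; first by rewrite !mul0r addr0 oner_neq0.
  apply: cvgD; first exact: cvg_cst.
  apply: cvgM => //; apply: cvgM; last exact: cvg_cst.
  exact: cvg_id.
Unshelve. all: by end_near. Qed.

(** After division by theta^d the denominator 1 + theta v^a T_v(theta) tends to
    v^a, which cancels the power of v in w and leaves (1 - v)^n. *)
Lemma Ifun_at_infinity alpha : alpha - n.+1%:R = a ->
  theta ^+ n.+1 * Ifun n.+1 alpha theta @[theta --> +oo] -->
  N^-1 * \int[mu]_(v in D) (1 - v) ^+ n.
Proof.
move=> alphaE.
pose h theta v := theta ^+ n.+1 * (w v / (1 + theta * v `^ a * T theta v)).
apply: (@cvg_trans _ (N^-1 * \int[mu]_(v in D) h theta v @[theta --> +oo])).
  apply: near_eq_cvg; near=> theta.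
  have t0 : 0 <= theta by near: theta; exact: nbhs_pinfty_ge.
  by rewrite IfunE// mulrCA /h RintegralZl//; exact: integrable_wphi.
apply: cvgM; first exact: cvg_cst.
apply: (cvg_Rintegral_pinfty _ _ 1).
- move=> theta t0; apply: measurable_funM => //; apply: measurable_funM => //.
  by apply: measurable_den; exact: ltW.
- by apply: measurable_funX; apply: measurable_funB.
- move=> theta v t0 v01; have /andP[w0 w1] := w_bound _ v01.
  have /andP[p0 p1] := powR_ge0_le1 _ v01.
  have /andP[q0 q1] := onemX_ge0_le1 _ v01.
  have d0 := den_gt0 _ _ (ltW t0) v01.
  have tT : theta ^+ n <= T theta v.
    by case/andP: v01 => /ltW v0 v1; apply: excess_ge_expn; rewrite ?v0 ?(ltW t0).
  rewrite /h ger0_norm; last first.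
    by rewrite mulr_ge0 ?exprn_ge0 ?divr_ge0// ltW.
  rewrite mulrA ler_pdivrMr// mul1r /w (@le_trans _ _ (theta ^+ n.+1 * v `^ a))//.
    by rewrite ler_wpM2l ?exprn_ge0 ?(ltW t0)// ler_piMr ?(ltW p0).
  rewrite -[leLHS]add0r lerD// exprS mulrAC ler_wpM2l// mulr_ge0 ?ltW//.
- move=> v v01; have /andP[p0 p1] := powR_ge0_le1 _ v01.
  (* dividing by theta ^+ n.+1 turns h into a function of 1 / theta *)
  pose rev : {poly R} := \poly_(i < n.+1) excess_coef a n (n - i)%N v.
  apply: (@cvg_trans _ (w v / (theta^-1 ^+ n.+1 + v `^ a * rev.[theta^-1])
      @[theta --> +oo])).
    apply: near_eq_cvg; near=> theta.
    have t0 : 0 < theta by near: theta; exact: nbhs_pinfty_gt.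
    rewrite /rev -excess_reverse ?gt_eqF// /h -/(T _ _) exprVn.
    have := den_gt0 _ _ (ltW t0) v01; have := exprn_gt0 n t0.
    rewrite exprS; move: (T _ _) (v `^ a) (w v) (theta ^+ n) => x y z s s0 d0.
    field.
    by rewrite !gt_eqF//=.
  have -> : (1 - v) ^+ n = w v / (0 ^+ n.+1 + v `^ a * rev.[0]).
    rewrite horner_coef0 coef_poly/= subn0 excess_coef_last// expr0n/= add0r mulr1.
    by rewrite /w mulrAC divff ?mul1r// gt_eqF.
  have ci : theta^-1 @[theta --> +oo] --> (0 : R) 
    by apply/(gtr0_cvgV0 (f := id)); [exact: nbhs_pinfty_gt|exact: cvg_id].
  have cpoly (p : {poly R}) : p.[theta^-1] @[theta --> +oo] --> p.[0].
    by apply: (cvg_comp _ _ ci); exact: continuous_horner.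
  apply: cvgM; first exact: cvg_cst.
  apply: cvgV.
    rewrite horner_coef0 coef_poly/= subn0 excess_coef_last// expr0n/= add0r mulr1.
    by rewrite gt_eqF.
  apply: cvgD; last by apply: cvgM; [exact: cvg_cst|exact: cpoly].
  have := cpoly ('X ^+ n.+1); rewrite horner_exp hornerX.
  by under eq_fun do rewrite horner_exp hornerX.
Unshelve. all: by end_near. Qed.

(** As T_v(0) >= 1, the integral is at least B(2 a + 1, n + 1). *)
Lemma limit_near0_gt0 :
  0 < N^-1 * \int[mu]_(v in D) (w v * (v `^ a * T 0 v)).
Proof.
rewrite mulr_gt0 ?invr_gt0//.
have aa : 0 < a + a + 1 by rewrite !addr_gt0.
have [K K0 TK] := excess_bounded a n a0.
apply: lt_le_trans (moment_onemX_exp_gt0 (a + a + 1) n aa) _.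
rewrite moment_unit_interval//.
have wE v : v `^ (a + a + 1 - 1) * ((1 - 'X) ^+ n).[v] = w v * v `^ a.
  have aa0 : (a + a == 0) = false by rewrite gt_eqF// addr_gt0.
  by rewrite addrK powRD ?aa0// /w horner_exp !hornerE mulrAC.
under eq_Rintegral do rewrite wE.
apply: le_Rintegral => //.
- apply: (integrable_unit_interval _ 1); first exact: measurable_funM.
  move=> v v01; have /andP[w0 w1] := w_bound _ v01.
  have /andP[p0 p1] := powR_ge0_le1 _ v01.
  by rewrite (ger0_norm (mulr_ge0 w0 (ltW p0))) mulr_ile1// ltW.
- apply: (integrable_unit_interval _ K).
    by apply: measurable_funM => //; exact: measurable_funM.
  move=> v v01; have /andP[w0 w1] := w_bound _ v01.
  have /andP[p0 p1] := powR_ge0_le1 _ v01.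
  have T1 := T_ge1 _ _ (lexx 0) v01; have T0 := le_trans ler01 T1.
  have TK' : T 0 v <= K.
    by case/andP: v01 => /ltW v0 v1; apply: TK; rewrite ?v0 ?lexx ?ler01.
  have q0 : 0 <= v `^ a * T 0 v by rewrite mulr_ge0 ?(ltW p0).
  rewrite (ger0_norm (mulr_ge0 w0 q0)).
  by apply: le_trans (ler_piMl q0 w1) _; rewrite (le_trans _ TK')// ler_piMl.
- move=> v; rewrite /= in_itv/= => v01; have /andP[w0 w1] := w_bound _ v01.
  have /andP[p0 p1] := powR_ge0_le1 _ v01.
  by rewrite ler_wpM2l// ler_peMr ?T_ge1// ltW.
Qed.

(** The integral is B(1, n + 1). *)
Lemma limit_at_infinity_gt0 : 0 < N^-1 * \int[mu]_(v in D) (1 - v) ^+ n.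
Proof.
rewrite mulr_gt0 ?invr_gt0//.
have := @moment_onemX_exp_gt0 R 1 n ltr01; rewrite moment_unit_interval//.
by under eq_Rintegral do rewrite subrr powRr0 mul1r horner_exp !hornerE.
Qed.

End limits.

Theorem mainTheorem5 (R : realType) (d : nat) (alpha : R)
    (hd : (1 <= d)%N) (halpha : d%:R < alpha) :
  exists C0 C1 : R,
    [/\ 0 < C0, 0 < C1,
        theta^-1 * (1 - Ifun d alpha theta) @[theta --> 0^'+] --> C0 &
        theta ^+ d * Ifun d alpha theta @[theta --> +oo] --> C1].
Proof.
case: d hd halpha => // n _ halpha.
have a0 : 0 < alpha - n.+1%:R by rewrite subr_gt0.
do 2 eexists; split; last 2 first.
- exact: (Ifun_near0 _ n a0 alpha erefl).
- exact: (Ifun_at_infinity _ n a0 alpha erefl).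
- exact: limit_near0_gt0.
- exact: limit_at_infinity_gt0.
Qed.
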